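(* There is a universal constant $c>0$ such that for every $n\ge1$, every $V:\{0,\dots,n\}\to\mathbb{R}$, and $H=-A+V$ with ground state distribution $p$ and spectral gap $\Delta$, the following hold. (1) (Uniform, log-concave) If $a_\ell=1$ for all $1\le\ell\le n$ and $p$ is log-concave, then $\Delta\ge c/n^2$. In particular this holds when $a_\ell=1$ for all $\ell$ and $V$ is single-well. (2) (Hypercube, log-concave) If $a_\ell=\sqrt{\ell(n+1-\ell)}$ for all $1\le\ell\le n$ and $p$ is log-concave, then $\Delta\ge c/n$. In particular this holds when $a_\ell=\sqrt{\ell(n+1-\ell)}$ for all $\ell$ and $H$ satisfies the $1$-RM condition. (3) (Hypercube, ultra-log-concave) If $a_\ell=\sqrt{\ell(n+1-\ell)}$ for all $1\le\ell\le n$ and $p$ is ultra-log-concave of order $n$, then $\Delta\ge c$. In particular this holds when $a_\ell=\sqrt{\ell(n+1-\ell)}$ for all $\ell$ and $V$ is convex.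
   Context: $H=-A+V$ is the real symmetric $(n+1)\times(n+1)$ matrix indexed by $\{0,\dots,n\}$, where $V$ is the diagonal matrix with entries $V(0),\dots,V(n)$ and $A_{k-1,k}=A_{k,k-1}=a_k>0$ for $1\le k\le n$, all other entries of $A$ being $0$. Its lowest eigenvalue $E_0$ is simple and the normalized eigenvector (ground state) $(\psi_k)_{k=0}^n$ is chosen with positive entries; the ground state distribution is $p_k=\psi_k^2$. The spectral gap $\Delta$ is the difference between the second lowest and lowest eigenvalue of $H$. A sequence $\{p_k\}_{k=0}^n$ is log-concave if $p_k^2\ge p_{k-1}p_{k+1}$ for $0<k<n$; it is ultra-log-concave of order $n$ if $\{p_k/\binom nk\}_{k=0}^n$ is log-concave. $V$ is single-well if $-V$ is unimodal, i.e. $V$ is non-increasing up to some index and non-decreasing from that index on. $V$ is convex if $V(k+1)+V(k-1)-2V(k)\ge0$ for $0<k<n$. The $1$-RM (relative monotonicity) condition: with $F(k)=V(k)-E_0$ (which is positive) and $a_0=a_{n+1}=0$, there is $k_0$ such that $$a_kF(k)-a_{k+1}F(k-1)\le\frac{a_1}{F(0)}\left(a_k^2-a_{k+1}a_{k-1}\right)\quad\text{for all }1\le k\le k_0,$$ $$a_{k+1}F(k)-a_kF(k+1)\le\frac{a_n}{F(n)}\left(a_{k+1}^2-a_{k+2}a_k\right)\quad\text{for all }k_0+1\le k\le n-1.$$ *)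

(* Defs.v *)
(* MathComp, over an arbitrary R : realType. *)
From mathcomp Require Import all_boot all_order all_algebra.
From mathcomp Require Import polyrcf reals.

Set Implicit Arguments.
Unset Strict Implicit.
Unset Printing Implicit Defensive.

Import Order.TTheory GRing.Theory Num.Theory.
Local Open Scope ring_scope.

Section Spectrum.
Variables (R : realType) (m : nat).
Implicit Type M : 'M[R]_m.

(* The real eigenvalues in increasing order, each repeated as many times as the
   dimension of its eigenspace.  [rootsR] lists the distinct real roots in
   increasing order; for a symmetric matrix of size m the list has length m. *)
Definition spectrum M : seq R :=
  flatten [seq nseq (\rank (eigenspace M x)) x | x <- rootsR (char_poly M)].

Definition lowest_eigenvalue M : R := (spectrum M)`_0.

Definition spectral_gap M : R := (spectrum M)`_1 - (spectrum M)`_0.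

End Spectrum.

(* Only the values a 1, ..., a n are used; a k is the weight of the edge
   {k - 1, k}. *)
Definition hopping (R : realType) (n : nat) (a : nat -> R) : 'M[R]_n.+1 :=
  \matrix_(i, j) (if j == i.+1 :> nat then a j
                  else if i == j.+1 :> nat then a i else 0).

Definition hamiltonian (R : realType) (n : nat) (a : nat -> R)
    (V : 'I_n.+1 -> R) : 'M[R]_n.+1 :=
  - hopping n a + diag_mx (\row_k V k).

Definition ground_state (R : realType) (n : nat) (H : 'M[R]_n.+1)
    (psi : 'cV[R]_n.+1) : Prop :=
  [/\ H *m psi = lowest_eigenvalue H *: psi,
      forall k, 0 < psi k 0
    & \sum_k psi k 0 ^+ 2 = 1].

Definition ground_dist (R : realType) (n : nat) (psi : 'cV[R]_n.+1)
    (k : 'I_n.+1) : R := psi k 0 ^+ 2.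

(* In what follows [inord k : 'I_n.+1] is the index k, and it is only used for
   0 <= k <= n. *)

Definition log_concave (R : realType) (n : nat) (p : 'I_n.+1 -> R) : Prop :=
  forall k : nat, (0 < k < n)%N ->
    p (inord k.-1) * p (inord k.+1) <= p (inord k) ^+ 2.

Definition ultra_log_concave (R : realType) (n : nat) (p : 'I_n.+1 -> R) :
    Prop :=
  log_concave (fun k => p k / 'C(n, k)%:R).

Definition single_well (R : realType) (n : nat) (V : 'I_n.+1 -> R) : Prop :=
  exists k0 : 'I_n.+1,
    (forall i j : 'I_n.+1, (i <= j <= k0)%N -> V j <= V i) /\
    (forall i j : 'I_n.+1, (k0 <= i <= j)%N -> V i <= V j).

Definition convex_potential (R : realType) (n : nat) (V : 'I_n.+1 -> R) :
    Prop :=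
  forall k : nat, (0 < k < n)%N ->
    0 <= V (inord k.+1) + V (inord k.-1) - 2 * V (inord k).

(* The 1-RM (relative monotonicity) condition; [b] is [a] on {1, ..., n}
   extended by b 0 = b n.+1 = 0. *)
Definition one_RM (R : realType) (n : nat) (a : nat -> R) (V : 'I_n.+1 -> R) :
    Prop :=
  let F (k : nat) := V (inord k) - lowest_eigenvalue (hamiltonian a V) in
  let b (k : nat) := if (1 <= k <= n)%N then a k else 0 in
  exists2 k0 : nat, (k0 <= n)%N &
    (forall k : nat, (1 <= k <= k0)%N ->
       b k * F k - b k.+1 * F k.-1
         <= b 1%N / F 0%N * (b k ^+ 2 - b k.+1 * b k.-1)) /\
    (forall k : nat, (k0.+1 <= k <= n.-1)%N ->
       b k.+1 * F k - b k * F k.+1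
         <= b n / F n * (b k.+1 ^+ 2 - b k.+2 * b k)).

(* Main.v *)
(** Let psi > 0 be the ground state, r_k = psi_k / psi_{k-1}, and let v be an
eigenvector for the second eigenvalue E_1.  The increments
u_k = v_k / psi_k - v_{k-1} / psi_{k-1} satisfy
  (E_1 - E_0) u_k = a_k (r_k + 1 / r_k) u_k - a_{k+1} r_{k+1} u_{k+1}
                    - (a_{k-1} / r_{k-1}) u_{k-1},
so at an index maximizing |u_k| / g_k, for any positive g, the right-hand side
with g in place of u bounds (E_1 - E_0) g_k from below.  If psi is log-concave,
g_k = y_k / (a_k sqrt (psi_{k-1} psi_k)) reduces the estimate to a concavity
bound on y: take y_k = k (n+1-k) in the uniform case and y = a on the
hypercube.  If p is ultra-log-concave then g = 1 already gives gap >= 1.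

The conditions on V give the required concavity of psi through the recursion
a_{k+1} r_{k+1} + a_k / r_k = V_k - E_0, run from both ends for 1-RM and
single-well potentials.  For convex V the increments of the normalized ratios
satisfy a linear inequality whose matrix is column diagonally dominant, and are
therefore nonpositive. *)
Require Import Defs.
From mathcomp Require Import all_boot all_order all_algebra.
From mathcomp Require Import polyrcf classical_sets reals.
From mathcomp Require Import zify ring lra.

Set Implicit Arguments.
Unset Strict Implicit.
Unset Printing Implicit Defensive.

Import Order.TTheory GRing.Theory Num.Theory.
Local Open Scope ring_scope.

(** * Gap bounds for Jacobi operators *)

Section Chain.
Variables (R : rcfType) (n : nat) (b V : nat -> R).

(** Sequences on [nat] give the boundary rows the same shape as the inner ones: the out-of-range
    neighbours enter only through the factors [b 0] and [b n.+1], which are assumed to vanish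
    below. *)
Definition jacobi_eigen (E : R) (x : nat -> R) : Prop :=
  forall k, (k <= n)%N -> V k * x k - b k * x k.-1 - b k.+1 * x k.+1 = E * x k.

Hypotheses (n_gt0 : (0 < n)%N) (b0 : b 0%N = 0) (bn : b n.+1 = 0).
Hypothesis b_gt0 : forall k, (0 < k <= n)%N -> 0 < b k.

Lemma edge_weight_ge0 k : (k <= n.+1)%N -> 0 <= b k.
Proof.
case: k => [|k]; first by rewrite b0.
rewrite ltnS leq_eqVlt => /orP[/eqP ->|kn]; first by rewrite bn.
by apply/ltW/b_gt0; rewrite kn.
Qed.

Variables (E : R) (psi : nat -> R).
Hypothesis psi_gt0 : forall k, (k <= n)%N -> 0 < psi k.
Hypothesis psiP : jacobi_eigen E psi.

Lemma ground_potentialE k : (k <= n)%N ->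
  V k - E = b k.+1 * (psi k.+1 / psi k) + b k * (psi k.-1 / psi k).
Proof.
move=> kn; have pk := psi_gt0 kn.
apply: (@mulIf _ (psi k)); first by rewrite gt_eqF.
by rewrite mulrBl -psiP //; field; rewrite gt_eqF.
Qed.

(** A maximum principle for the increments [u] of [v / psi]: [g] is a positive supersolution of the
    tridiagonal system that [u] solves, and the two are compared where [|u| / g] is largest. *)
Lemma gap_ge_supersolution (E' : R) (v g : nat -> R) (c : R) :
  jacobi_eigen E' v -> E' != E ->
  (exists2 k, (k <= n)%N & v k != 0) ->
  (forall k, (0 < k <= n)%N -> 0 < g k) ->
  (forall k, (0 < k <= n)%N ->
     c * g k <= b k * (psi k / psi k.-1 + psi k.-1 / psi k) * g k
                - b k.+1 * (psi k.+1 / psi k) * g k.+1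
                - b k.-1 * (psi k.-2 / psi k.-1) * g k.-1) ->
  c <= E' - E.
Proof.
move=> vP EE' [k1 k1n vk1] g_gt0 gP.
pose f k := v k / psi k; pose u k := f k - f k.-1.
(* Put [v = psi * f] in row [k] and subtract [f k] times the row of [psi]: the potential cancels and
   only differences of [f] remain. *)
have fP k : (k <= n)%N ->
    (E' - E) * f k = b k * (psi k.-1 / psi k) * u k
                     - b k.+1 * (psi k.+1 / psi k) * u k.+1.
  move=> kn; have pk := psi_gt0 kn.
  have h j : (j <= n)%N -> v j = psi j * f j.
    by move=> jn; rewrite mulrC /f divfK // gt_eqF // psi_gt0.
  have e1 : b k * v k.-1 = b k * (psi k.-1 * f k.-1).
    by rewrite h //; lia.
  have e2 : b k.+1 * v k.+1 = b k.+1 * (psi k.+1 * f k.+1).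
    have [->|kn1] := eqVneq k n; first by rewrite bn !mul0r.
    by rewrite h //; lia.
  have := vP k kn; rewrite e1 e2 (h k kn) => vk; have pE := psiP kn.
  apply: (@mulIf _ (psi k)); first by rewrite gt_eqF.
  have -> : (b k * (psi k.-1 / psi k) * u k - b k.+1 * (psi k.+1 / psi k) * u k.+1)
            * psi k = b k * psi k.-1 * u k - b k.+1 * psi k.+1 * u k.+1.
    by field; rewrite gt_eqF.
  move: vk pE; rewrite /u /=.
  set F := f k; set P := psi k.
  have -> : (E' - E) * F * P = E' * (P * F) - (E * P) * F by ring.
  by move=> <- <-; ring.
(* The difference of [fP] at [k] and at [k.-1] is a closed system for [u]. *)
have uP k : (0 < k <= n)%N ->
    (E' - E) * u k = b k * (psi k / psi k.-1 + psi k.-1 / psi k) * u k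
                - b k.+1 * (psi k.+1 / psi k) * u k.+1
                - b k.-1 * (psi k.-2 / psi k.-1) * u k.-1.
  case: k => // k /= kn; rewrite [u k.+1 in LHS]/u mulrBr fP // fP 1?ltnW //=.
  by ring.
pose m0 : 'I_n := Ordinal n_gt0.
pose w (i : 'I_n) := `|u i.+1| / g i.+1.
pose i := [arg max_(i > m0) w i]%O.
have wmax (j : 'I_n) : w j <= w i.
  by rewrite /i; case: arg_maxP => // l _; apply.
have umax k : (0 < k <= n)%N -> `|u k| <= w i * g k.
  case: k => // k /= kn; rewrite -ler_pdivrMr ?g_gt0 //.
  exact: (wmax (Ordinal kn)).
have gi : 0 < g i.+1 by rewrite g_gt0 //=.
(* If the maximum were 0, all increments would vanish, and [fP] with [E' != E] would force
   [v = 0]. *)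
have wi : 0 < w i.
  rewrite lt_neqAle [X in _ && X]divr_ge0 ?normr_ge0 ?(ltW gi) // andbT.
  apply/negP => /eqP wi0.
  have u0 k : (0 < k <= n)%N -> u k = 0.
    by move=> /umax; rewrite -wi0 mul0r normr_le0 => /eqP.
  have f0 : f k1 = 0.
    have : (E' - E) * f k1 = 0.
      rewrite fP //.
      have -> : b k1 * (psi k1.-1 / psi k1) * u k1 = 0.
        case: (k1) k1n => [|k] kn; first by rewrite b0 !mul0r.
        by rewrite u0 ?mulr0.
      have [->|kn] := eqVneq k1 n; first by rewrite bn !mul0r subr0.
      by rewrite u0 ?mulr0 ?subr0 //; lia.
    by move/eqP; rewrite mulf_eq0 subr_eq0 (negPf EE') => /eqP.
  move/eqP: f0; rewrite mulf_eq0 (negPf vk1) invr_eq0 gt_eqF //.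
  exact: psi_gt0.
have iP : (0 < i.+1 <= n)%N by rewrite /= ltn_ord.
have ui : `|u i.+1| = w i * g i.+1 by rewrite /w divfK // gt_eqF.
have up1 : `|b i.+2 * (psi i.+2 / psi i.+1) * u i.+2|
           <= w i * (b i.+2 * (psi i.+2 / psi i.+1) * g i.+2).
  have [->|kn] := eqVneq i.+1 n; first by rewrite bn !mul0r normr0 mulr0.
  have kn2 : (i.+2 <= n)%N by have := ltn_ord i; lia.
  have c0 : 0 <= b i.+2 * (psi i.+2 / psi i.+1).
    by rewrite mulr_ge0 ?divr_ge0 ?edge_weight_ge0 ?ltW ?psi_gt0 // ltnW.
  by rewrite normrM (ger0_norm c0) [leRHS]mulrCA ler_wpM2l // umax.
have um1 : `|b i * (psi i.-1 / psi i) * u i|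
           <= w i * (b i * (psi i.-1 / psi i) * g i).
  have [->|kn] := eqVneq (i : nat) 0%N; first by rewrite b0 !mul0r normr0 mulr0.
  have kn2 : (i <= n)%N by apply: ltnW.
  have c0 : 0 <= b i * (psi i.-1 / psi i).
    by rewrite mulr_ge0 ?divr_ge0 ?edge_weight_ge0 ?ltW ?psi_gt0 //; lia.
  by rewrite normrM (ger0_norm c0) [leRHS]mulrCA ler_wpM2l // umax // kn2; lia.
have := gP _ iP; have := uP _ iP; rewrite /=.
set d := b i.+1 * _; set x := _ * u i.+2 in up1 *; set y := _ * u i in um1 *.
set x' := _ * g i.+2 in up1 *; set y' := _ * g i in um1 *.
move=> eqn cg.
(* At the maximizing index the two neighbour terms are at most [w i] times their analogues for [g],
   whose sum is at most [(d - c) * g i.+1]. Dividing by [|u i.+1| > 0] bounds [|d - (E' - E)|] by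
   [d - c]. *)
have h : `|d - (E' - E)| * `|u i.+1| <= (d - c) * `|u i.+1|.
  rewrite -normrM mulrBl eqn.
  have -> : d * u i.+1 - (d * u i.+1 - x - y) = x + y by ring.
  apply: le_trans (ler_normD _ _) _; rewrite ui.
  apply: le_trans (lerD up1 um1) _; rewrite -mulrDr [leRHS]mulrCA ler_pM2l //.
  by lra.
have {h} : `|d - (E' - E)| <= d - c.
  by rewrite -(ler_pM2r (x := `|u i.+1|)) // ui mulr_gt0.
by have := ler_norm (d - (E' - E)); lra.
Qed.

(** Let [z] be the square root of [psi k.-1 * psi k]. Log-concavity bounds the two neighbour terms
    by [y k.+1 / z] and [y k.-1 / z], and [r + 1 / r >= 2] bounds the diagonal below by
    [2 * y k / z], so only the second difference of [y] is left. At the ends the neighbour term is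
    0, whence the signs of [y 0] and [y n.+1]. *)
Lemma gap_ge_log_concave (E' : R) (v y : nat -> R) (c : R) :
  jacobi_eigen E' v -> E' != E ->
  (exists2 k, (k <= n)%N & v k != 0) ->
  (forall k, (0 < k < n)%N -> psi k.-1 * psi k.+1 <= psi k ^+ 2) ->
  (forall k, (0 < k <= n)%N -> 0 < y k) -> 0 <= y 0%N -> 0 <= y n.+1 ->
  (forall k, (0 < k <= n)%N ->
     c * y k <= b k * (2 * y k - y k.+1 - y k.-1)) ->
  c <= E' - E.
Proof.
move=> vP EE' v0 lc y_gt0 y0 yn yP.
pose s k := Num.sqrt (psi k).
have s_gt0 k : (k <= n)%N -> 0 < s k by move=> kn; rewrite sqrtr_gt0 psi_gt0.
have sE k : (k <= n)%N -> psi k = s k ^+ 2.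
  by move=> kn; rewrite sqr_sqrtr // ltW // psi_gt0.
have slc k : (0 < k < n)%N -> s k.-1 * s k.+1 <= s k ^+ 2.
  move=> kn; have := lc k kn; rewrite !sE; try lia.
  by rewrite -exprMn ler_sqr // nnegrE ?mulr_ge0 ?exprn_ge0 // ltW // s_gt0 //; lia.
(* This choice of g symmetrizes the operator acting on the increments. *)
pose g k := y k / (b k * (s k.-1 * s k)).
apply: (gap_ge_supersolution (v := v) (g := g)) => // -[//|k] /= kn.
  by rewrite /g divr_gt0 ?y_gt0 // !mulr_gt0 ?b_gt0 ?s_gt0 // ltnW.
have kn' := ltnW kn.
have s1 := s_gt0 _ kn'; have s2 := s_gt0 _ kn.
have bk : 0 < b k.+1 by apply: b_gt0.
rewrite (sE k.+1) // (sE k) //.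
set z := s k * s k.+1; have z0 : 0 < z by rewrite mulr_gt0.
have up : b k.+2 * (psi k.+2 / s k.+1 ^+ 2) * g k.+2 <= y k.+2 / z.
  have [->|kn1] := eqVneq k.+1 n; first by rewrite bn !mul0r divr_ge0 // ltW.
  have k3 : (k.+2 <= n)%N by rewrite ltn_neqAle kn1.
  have s3 := s_gt0 _ k3; have bk1 : 0 < b k.+2 by apply: b_gt0.
  have -> : b k.+2 * (psi k.+2 / s k.+1 ^+ 2) * g k.+2 =
            y k.+2 / z * (s k * s k.+2 / s k.+1 ^+ 2).
    by rewrite /g /z /= !sE //; field; rewrite !gt_eqF.
  rewrite ler_piMr //.
    by rewrite ltW // divr_gt0 ?y_gt0 // mulr_gt0.
  by rewrite ler_pdivrMr ?mul1r ?exprn_gt0 // (slc k.+1).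
have um : b k * (psi k.-1 / s k ^+ 2) * g k <= y k / z.
  case: k kn kn' s1 s2 bk @z z0 {up} => [|k] kn kn' s1 s2 bk z z0.
    by rewrite b0 !mul0r divr_ge0 // ltW.
  rewrite /=.
  have k3 : (k <= n)%N by apply: ltnW.
  have s3 := s_gt0 _ k3; have bk1 : 0 < b k.+1 by apply: b_gt0.
  have -> : b k.+1 * (psi k / s k.+1 ^+ 2) * g k.+1 =
            y k.+1 / z * (s k * s k.+2 / s k.+1 ^+ 2).
    by rewrite /g /z /= !sE //; field; rewrite !gt_eqF.
  rewrite ler_piMr //.
    by rewrite ltW // divr_gt0 ?y_gt0 // mulr_gt0.
  by rewrite ler_pdivrMr ?mul1r ?exprn_gt0 // (slc k.+1).
have diag : 2 * (y k.+1 / z) <=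
    b k.+1 * (s k.+1 ^+ 2 / s k ^+ 2 + s k ^+ 2 / s k.+1 ^+ 2) * g k.+1.
  have -> : b k.+1 * (s k.+1 ^+ 2 / s k ^+ 2 + s k ^+ 2 / s k.+1 ^+ 2) * g k.+1 =
      2 * (y k.+1 / z) + ((s k.+1 ^+ 2 - s k ^+ 2) / z) ^+ 2 * (y k.+1 / z).
    by rewrite /g /z /=; field; rewrite !gt_eqF.
  by rewrite lerDl mulr_ge0 ?sqr_ge0 // ltW // divr_gt0 // y_gt0.
have : c * g k.+1 <= 2 * (y k.+1 / z) - y k.+2 / z - y k / z.
  have -> : c * g k.+1 = (c * y k.+1 / b k.+1) / z.
    by rewrite /g /z /=; field; rewrite !gt_eqF.
  rewrite mulrA -!mulrBl ler_pM2r ?invr_gt0 // ler_pdivrMr // [leRHS]mulrC.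
  exact: yP.
lra.
Qed.

(** With [g = 1] the diagonal is [(n+1-k) t_k + k / t_k]; monotonicity of [t] bounds the neighbour
    terms by [(n-k) t_k] and [(k-1) / t_k]. The difference [t_k + 1 / t_k] is at least 1. *)
Lemma gap_ge_ultra_log_concave (E' : R) (v t : nat -> R) :
  jacobi_eigen E' v -> E' != E ->
  (exists2 k, (k <= n)%N & v k != 0) ->
  (forall k, (0 < k <= n)%N -> 0 < t k) ->
  (forall k, (0 < k <= n)%N -> b k * (psi k / psi k.-1) = (n.+1 - k)%:R * t k) ->
  (forall k, (0 < k <= n)%N -> b k * (psi k.-1 / psi k) = k%:R / t k) ->
  (forall k, (0 < k < n)%N -> t k.+1 <= t k) ->
  1 <= E' - E.
Proof.
move=> vP EE' v0 t_gt0 tP tP' tmono.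
apply: (gap_ge_supersolution (v := v) (g := fun=> 1)) => // k kn.
rewrite mulrDr tP // tP' // !mulr1 /=; have tk := t_gt0 k kn.
have up : b k.+1 * (psi k.+1 / psi k) <= (n - k)%:R * t k.
  have [->|kn1] := eqVneq k n; first by rewrite bn subnn !mul0r.
  rewrite (tP k.+1); last by lia.
  by rewrite subSS ler_wpM2l ?ler0n // tmono //; lia.
have um : b k.-1 * (psi k.-2 / psi k.-1) <= k.-1%:R / t k.
  have [->|kn1] := eqVneq k 1%N; first by rewrite b0 !mul0r.
  rewrite tP'; last by lia.
  rewrite ler_wpM2l ?ler0n // lef_pV2 ?posrE ?t_gt0 //; try lia.
  have := tmono k.-1; have -> : k.-1.+1 = k by lia.
  by apply; lia.
have e1 : (n.+1 - k)%:R = (n - k)%:R + 1 :> R by rewrite natr1; congr _%:R; lia.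
have e2 : k%:R = k.-1%:R + 1 :> R by rewrite natr1; congr _%:R; lia.
rewrite e1 e2 !mulrDl !mul1r.
have : 1 <= t k + (t k)^-1.
  have : 0 < (t k)^-1 by rewrite invr_gt0.
  case: (lerP 1 (t k)) => [|t1]; first by lra.
  have : 1 <= (t k)^-1 by rewrite invf_ge1 // ltW.
  by lra.
lra.
Qed.

(** The 1-RM inequalities for an arbitrary [F], at the indices [k < n] where both ratios [r k] and
    [r k.+1] exist. Both 1-RM and single-well potentials are reduced to this form. *)
Definition rel_mono F :=
  exists k0 : nat,
    (forall k, (0 < k <= k0)%N -> (k < n)%N ->
       b k * F k - b k.+1 * F k.-1
         <= b 1%N / F 0%N * (b k ^+ 2 - b k.+1 * b k.-1)) /\
    (forall k, (k0 < k < n)%N ->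
       b k.+1 * F k - b k * F k.+1
         <= b n / F n * (b k.+1 ^+ 2 - b k.+2 * b k)).

(** Log-concavity says that [r] is nonincreasing. Inserting [F k = b k.+1 * r k.+1 + b k / r k] in
    the first condition leaves [b k * b k.+1 * (r k.+1 - r k)] plus a term which, by the
    monotonicity already known, is at least the right-hand side. *)
Lemma ground_log_concave_of_rel_mono :
  (forall k, (0 < k <= n)%N -> b k.-1 * b k.+1 <= b k ^+ 2) ->
  rel_mono (fun k => V k - E) ->
  forall k, (0 < k < n)%N -> psi k.-1 * psi k.+1 <= psi k ^+ 2.
Proof.
move=> blc [k0 [left_mono right_mono]].
pose r k := psi k / psi k.-1.
have r_gt0 k : (0 < k <= n)%N -> 0 < r k.
  by move=> kn; rewrite divr_gt0 ?psi_gt0 //; lia.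
have rV k : (r k)^-1 = psi k.-1 / psi k by rewrite invf_div.
have FP k : (k <= n)%N -> V k - E = b k.+1 * r k.+1 + b k / r k.
  by move=> kn; rewrite ground_potentialE // rV.
(* The end rows have a single hopping term, so the two constants of the condition are [1 / r 1] and
   [r n]. *)
have F0 : b 1%N / (V 0%N - E) = (r 1%N)^-1.
  rewrite FP // b0 mul0r addr0; have := b_gt0 (k := 1); have := r_gt0 1%N.
  by rewrite n_gt0 => /(_ isT) h1 /(_ isT) h2; field; rewrite !gt_eqF.
have Fn : b n / (V n - E) = r n.
  rewrite FP // bn mul0r add0r; have := b_gt0 (k := n); have := r_gt0 n.
  by rewrite n_gt0 leqnn => /(_ isT) h1 /(_ isT) h2; field; rewrite !gt_eqF.
(* The comparison with [r 1] is carried along because the right-hand side contains [1 / r 1]. *)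
have rleft k : (0 < k <= k0)%N -> (k < n)%N -> r k.+1 <= r k /\ r k.+1 <= r 1%N.
  elim: k => // k IH kk kn.
  have rk : r k.+1 <= r 1%N by case: (k) IH kk kn => // j IH kk kn; apply IH; lia.
  suff h : r k.+2 <= r k.+1 by split=> //; apply: le_trans h rk.
  have := left_mono k.+1 kk kn; rewrite F0 !FP; try lia; rewrite /=.
  have b1 : 0 < b k.+1 by rewrite b_gt0 //; lia.
  have b2 : 0 < b k.+2 by rewrite b_gt0 //; lia.
  have r1 : 0 < r k.+1 by rewrite r_gt0 //; lia.
  have rV1 : 0 <= (r k.+1)^-1 - (r 1%N)^-1.
    by rewrite subr_ge0 lef_pV2 ?posrE ?r_gt0 //; lia.
  have bb : 0 <= b k.+1 ^+ 2 - b k.+2 * b k.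
    by rewrite subr_ge0 mulrC; apply: (blc k.+1); lia.
  have br : b k / r k.+1 >= b k / r k.
    case: (k) IH kk kn => [|j] IH kk kn; first by rewrite b0 !mul0r.
    rewrite ler_wpM2l ?edge_weight_ge0 //; try lia.
    by rewrite lef_pV2 ?posrE ?r_gt0 //; [apply IH|..]; lia.
  move=> h; rewrite -subr_ge0 -(pmulr_rge0 _ (mulr_gt0 b1 b2)).
  have := mulr_ge0 rV1 bb; have := ler_wpM2l (ltW b2) br.
  set p := (r k.+1)^-1 in h *; set q := (r 1%N)^-1 in h *.
  set s := b k / r k in h *.
  by nra.
(* The mirror image: induction on the distance to [n], with [r n] as reference. *)
have rright k : (k0 < k < n)%N -> r k.+1 <= r k /\ r n <= r k.
  have [m] := ubnP (n - k); elim: m k => // m IH k km kk.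
  have rk : r n <= r k.+1.
    by have [->//|kn] := eqVneq k.+1 n; apply IH; lia.
  suff h : r k.+1 <= r k by split=> //; apply: le_trans rk h.
  have := right_mono k kk; rewrite Fn !FP; try lia; rewrite /=.
  have b1 : 0 < b k by rewrite b_gt0 //; lia.
  have b2 : 0 < b k.+1 by rewrite b_gt0 //; lia.
  have r1 : 0 < r k.+1 by rewrite r_gt0 //; lia.
  have r0 : 0 < r k by rewrite r_gt0 //; lia.
  have rV1 : 0 <= r k.+1 - r n by rewrite subr_ge0.
  have bb : 0 <= b k.+1 ^+ 2 - b k.+2 * b k.
    by rewrite subr_ge0 mulrC; apply: (blc k.+1); lia.
  have br : b k.+2 * r k.+2 <= b k.+2 * r k.+1.
    have [->|kn] := eqVneq k.+1 n; first by rewrite bn !mul0r.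
    rewrite ler_wpM2l ?edge_weight_ge0 //; try lia.
    by apply IH; lia.
  move=> h; rewrite -lef_pV2 ?posrE // -subr_ge0 -(pmulr_rge0 _ (mulr_gt0 b1 b2)).
  have := mulr_ge0 rV1 bb; have := ler_wpM2l (ltW b1) br.
  set p := (r k.+1)^-1 in h *; set q := (r k)^-1 in h *.
  by nra.
move=> k kn.
have pk1 : 0 < psi k.-1 by rewrite psi_gt0 //; lia.
have pk : 0 < psi k by rewrite psi_gt0 //; lia.
have : r k.+1 <= r k.
  by case: (leqP k k0) => kk0; [apply (rleft k)|apply (rright k)]; lia.
by rewrite /r ler_pdivlMr // mulrAC ler_pdivrMr // mulrC -expr2.
Qed.


(** With [D k = t k.+1 - t k] and [Q k = 1 / t k - 1 / t k.+1], convexity at [k] reads [(n-k+1) D_k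
    + (k+1) Q_k <= (n-k-1) D_{k+1} + (k-1) Q_{k-1}]. Since [D k] and [Q k] have the same sign, the
    inequality passes to positive parts. *)
Lemma ground_ratio_nonincreasing_of_convex (t : nat -> R) :
  (forall k, (0 < k <= n)%N -> 0 < t k) ->
  (forall k, (0 < k <= n)%N -> b k * (psi k / psi k.-1) = (n.+1 - k)%:R * t k) ->
  (forall k, (0 < k <= n)%N -> b k * (psi k.-1 / psi k) = k%:R / t k) ->
  (forall k, (0 < k < n)%N -> 0 <= V k.+1 + V k.-1 - 2 * V k) ->
  forall k, (0 < k < n)%N -> t k.+1 <= t k.
Proof.
move=> t_gt0 tP tP' convV.
pose p k := (t k)^-1.
have VE k : (k <= n)%N -> V k = E + (n - k)%:R * t k.+1 + k%:R * p k.
  move=> kn; have -> : V k = E + (V k - E) by rewrite addrC subrK.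
  rewrite ground_potentialE // addrA; congr (_ + _ + _).
    have [->|kn1] := eqVneq k n; first by rewrite bn subnn !mul0r.
    have kn2 : (0 < k.+1 <= n)%N by rewrite /= ltn_neqAle kn1.
    by rewrite (tP _ kn2) subSS.
  by case: k kn => [|k] kn; [rewrite b0 !mul0r|rewrite tP'].
pose x k := Num.max (t k.+1 - t k) 0.
pose y k := Num.max (p k - p k.+1) 0.
(* Summing the convexity inequalities over the k with increasing t
   telescopes: T increases by at least the positive part of t k.+2 - t k.+1,
   but starts nonnegative and ends nonpositive. *)
pose T k := (n - k.+1)%:R * x k.+1 - k%:R * y k.
have x_ge0 k : 0 <= x k by rewrite /x le_max lexx orbT.
have y_ge0 k : 0 <= y k by rewrite /y le_max lexx orbT.
have Tstep k : (k.+1 < n)%N -> T k + x k.+1 <= T k.+1.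
  move=> kn; rewrite /T.
  have t1 : 0 < t k.+1 by rewrite t_gt0 //; lia.
  have t2 : 0 < t k.+2 by rewrite t_gt0.
  have := convV k.+1 kn; rewrite !VE /=; try lia.
  have -> : (n - k.+2)%:R = (n - k.+1)%:R - 1 :> R.
    by apply/eqP; rewrite eq_sym subr_eq natr1 -subSn.
  have -> : (n - k)%:R = (n - k.+1)%:R + 1 :> R.
    by rewrite natr1 -subSn // ltnW.
  have N1 : 1 <= (n - k.+1)%:R :> R by rewrite ler1n; lia.
  rewrite -!(natr1 k.+1) -!(natr1 k).
  have k0 : 0 <= k%:R :> R by rewrite ler0n.
  move: N1 k0; set N := (n - k.+1)%:R; set K := k%:R => N1 k0 conv.
  have N0 : 0 <= N - 1 by rewrite subr_ge0.
  have xt : t k.+3 - t k.+2 <= x k.+2 by rewrite le_max lexx.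
  have yt : p k - p k.+1 <= y k by rewrite le_max lexx.
  have := ler_wpM2l N0 xt; have := ler_wpM2l k0 yt.
  have := mulr_ge0 N0 (x_ge0 k.+2); have := mulr_ge0 k0 (y_ge0 k).
  case: (lerP (t k.+2) (t k.+1)) => tt.
    have -> : x k.+1 = 0 by rewrite /x max_r // subr_le0.
    have -> : y k.+1 = 0 by rewrite /y max_r // subr_le0 lef_pV2.
    by lra.
  have pp : p k.+2 < p k.+1 by rewrite ltf_pV2.
  have -> : x k.+1 = t k.+2 - t k.+1 by rewrite /x max_l // subr_ge0 ltW.
  have -> : y k.+1 = p k.+1 - p k.+2 by rewrite /y max_l // subr_ge0 ltW.
  by move: conv; lra.
have T0 k : (k < n)%N -> 0 <= T k.
  elim: k => [|k IH] kn; first by rewrite /T mul0r subr0 mulr_ge0 ?ler0n.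
  by apply: le_trans (Tstep k kn); rewrite addr_ge0 // IH // ltnW.
have Tlast : T n.-1 <= 0.
  by rewrite /T prednK // subnn mul0r sub0r oppr_le0 mulr_ge0 ?ler0n.
have Tmono d k : (k + d < n)%N -> T k <= T (k + d)%N.
  elim: d => [|d IH]; rewrite ?addn0 ?addnS // => kn.
  apply: le_trans (IH (ltnW kn)) _; apply: le_trans (Tstep _ kn).
  by rewrite lerDl.
case=> // k /= kn.
suff : x k.+1 <= 0 by rewrite ge_max subr_le0 => /andP[].
have Tk : T k.+1 <= T n.-1.
  have := Tmono (n.-1 - k.+1)%N k.+1.
  by rewrite subnKC; [apply|]; lia.
have := Tstep k kn; have := T0 k (ltnW kn); lra.
Qed.
End Chain.

(** * Extremal eigenvectors of symmetric matrices *)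

Section QuadraticForm.
Variables (R : realType) (m : nat).
Implicit Types (A : 'M[R]_m) (u v : 'rV[R]_m).

Definition dot u v : R := (u *m v^T) 0 0.

Lemma dotE u v : dot u v = \sum_i u 0 i * v 0 i.
Proof. by rewrite /dot mxE; apply: eq_bigr => i _; rewrite mxE. Qed.

Lemma dotC u v : dot u v = dot v u.
Proof. by rewrite !dotE; apply: eq_bigr => i _; rewrite mulrC. Qed.

Lemma dotBl u u' v : dot (u - u') v = dot u v - dot u' v.
Proof. by rewrite /dot mulmxBl !mxE. Qed.

Lemma dotBr u v v' : dot u (v - v') = dot u v - dot u v'.
Proof. by rewrite dotC dotBl !(dotC u). Qed.

Lemma dotZl c u v : dot (c *: u) v = c * dot u v.
Proof. by rewrite /dot -scalemxAl !mxE. Qed.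

Lemma dotZr c u v : dot u (c *: v) = c * dot u v.
Proof. by rewrite dotC dotZl dotC. Qed.

Lemma dot_ge0 u : 0 <= dot u u.
Proof. by rewrite dotE sumr_ge0 // => i _; rewrite -expr2 sqr_ge0. Qed.

Lemma sqr_le_dot u i : u 0 i ^+ 2 <= dot u u.
Proof.
rewrite dotE (bigD1 i) //= -expr2 lerDl sumr_ge0 // => j _.
by rewrite -expr2 sqr_ge0.
Qed.

Lemma dot_eq0 u : dot u u <= 0 -> u = 0.
Proof.
move=> u0; apply/rowP => i; rewrite mxE; apply/eqP; rewrite -sqrf_eq0.
by rewrite eq_le sqr_ge0 andbT (le_trans (sqr_le_dot u i)).
Qed.

Lemma dot_gt0 u : u != 0 -> 0 < dot u u.
Proof. by rewrite ltNge; apply: contra => /dot_eq0 ->. Qed.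

Lemma dot_mul_sym A u v : A^T = A -> dot (u *m A) v = dot u (v *m A).
Proof. by move=> sA; rewrite /dot trmx_mul sA mulmxA. Qed.

(** Each product [|u_i u_j|] is at most [dot u u]; the summand 1 keeps [K] positive, hence
    invertible. *)
Lemma quad_bound A : exists2 K : R, 0 < K & forall u, dot (u *m A) u <= K * dot u u.
Proof.
exists (1 + \sum_j \sum_i `|A i j|) => [|u].
  by rewrite ltr_pwDl // sumr_ge0 // => j _; rewrite sumr_ge0.
rewrite mulrDl mul1r; apply: ler_wpDl; first exact: dot_ge0.
rewrite dotE mulr_suml; apply: ler_sum => j _.
rewrite mxE !mulr_suml; apply: ler_sum => i _.
apply: le_trans (ler_norm _) _; rewrite mulrAC normrM [leLHS]mulrC.
apply: ler_wpM2l => //.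
have := sqr_le_dot u i; have := sqr_le_dot u j.
rewrite -(real_normK (num_real (u 0 i))) -(real_normK (num_real (u 0 j))) normrM.
by have := sqr_ge0 (`|u 0 i| - `|u 0 j|); nra.
Qed.

Lemma quad_sub A u v s : A^T = A ->
  dot ((u - s *: v) *m A) (u - s *: v) =
  dot (u *m A) u - 2 * s * dot (u *m A) v + s ^+ 2 * dot (v *m A) v.
Proof.
move=> sA; rewrite mulmxBl -scalemxAl !(dotBl, dotBr, dotZl, dotZr).
by rewrite (dot_mul_sym v u sA) (dotC v); ring.
Qed.

Definition psd A := forall u, 0 <= dot (u *m A) u.

(** Nonnegativity of the form at [u - s (u A)] with [s = 1 / K] gives [0 <= - s |u A|^2], because
    the form at [u A] is at most [K |u A|^2]. *)
Lemma psd_ker A u : A^T = A -> psd A -> dot (u *m A) u = 0 -> u *m A = 0.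
Proof.
move=> sA pA u0; apply: dot_eq0; have [K K0 KP] := quad_bound A.
have := pA (u - K^-1 *: (u *m A)); rewrite quad_sub // u0.
have := KP (u *m A); set d := dot (u *m A) (u *m A); set q := dot _ _ => h1 h2.
have : K^-1 ^+ 2 * q <= K^-1 * d.
  by rewrite expr2 -mulrA ler_pM2l ?invr_gt0 // ler_pdivrMl.
have Ki : 0 < K^-1 by rewrite invr_gt0.
by move=> h3; rewrite -(pmulr_rle0 _ Ki); lra.
Qed.

(* Expand the form at u - K^-1 u A^-1, where K bounds the form of A^-1. *)
Lemma psd_unit_coercive A : A^T = A -> psd A -> A \in unitmx ->
  exists2 e : R, 0 < e & forall u, e * dot u u <= dot (u *m A) u.
Proof.
move=> sA pA uA; have [K K0 KP] := quad_bound (invmx A).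
have Ki : 0 < K^-1 by rewrite invr_gt0.
exists K^-1 => // u; have := pA (u - K^-1 *: (u *m invmx A)); rewrite quad_sub //.
rewrite mulmxKV // [dot (u *m A) (u *m _)](dot_mul_sym _ _ sA) mulmxKV //.
rewrite (dotC u (u *m _)).
have := KP u; set q := dot (u *m invmx A) u; set d := dot u u => h1.
have : K^-1 ^+ 2 * q <= K^-1 * d.
  by rewrite expr2 -mulrA ler_pM2l // ler_pdivrMl.
by lra.
Qed.

End QuadraticForm.

Local Open Scope classical_set_scope.

(* If mu is the supremum of the t with A - t psd, then A - mu is singular:
   otherwise it would be coercive. *)
Lemma symmetric_min_eigen (R : realType) (m : nat) (A : 'M[R]_m.+1) : A^T = A ->
  exists mu : R, (forall u : 'rV_m.+1, mu * dot u u <= dot (u *m A) u) /\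
    exists2 u : 'rV_m.+1, u != 0 & u *m A = mu *: u.
Proof.
move=> sA; pose S := [set t : R | forall u : 'rV_m.+1, t * dot u u <= dot (u *m A) u].
have S0 : S !=set0.
  have [K K0 KP] := quad_bound (- A); exists (- K) => u.
  have := KP u; rewrite mulmxN -scaleN1r dotZl; lra.
have [e e1] : exists e : 'rV[R]_m.+1, 0 < dot e e.
  exists (delta_mx 0 0); apply: dot_gt0; apply/eqP => /rowP/(_ 0)/eqP.
  by rewrite !mxE !eqxx oner_eq0.
have ubS : has_ubound S.
  exists (dot (e *m A) e / dot e e) => t /(_ e); by rewrite -ler_pdivlMr.
pose mu := sup S.
have muS : S mu.
  move=> u; have [->|u0] := eqVneq u 0; first by rewrite mul0mx /dot mul0mx mxE mulr0.
  rewrite -ler_pdivlMr ?dot_gt0 //; apply: ge_sup => // t /(_ u).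
  by rewrite -ler_pdivlMr // dot_gt0.
exists mu; split=> //.
pose B := A - mu%:M.
have sB : B^T = B by rewrite /B linearB /= sA tr_scalar_mx.
have BE u : dot (u *m B) u = dot (u *m A) u - mu * dot u u.
  by rewrite mulmxBr mul_mx_scalar dotBl dotZl.
have pB : psd B by move=> u; rewrite BE subr_ge0; apply: muS.
have [uB|] := boolP (B \in unitmx).
  have [d d0 dP] := psd_unit_coercive sB pB uB.
  have : mu + d <= mu.
    apply: (ub_le_sup ubS) => u; have := dP u; rewrite BE mulrDl; lra.
  by rewrite gerDl leNgt d0.
rewrite -row_free_unit -kermx_eq0 => /rowV0Pn[u uker u0]; exists u => //.
move/sub_kermxP: uker; rewrite mulmxBr mul_mx_scalar => /eqP.
by rewrite subr_eq0 => /eqP.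
Qed.
Local Close Scope classical_set_scope.

(** * Spectrum of the Hamiltonian *)

Section JacobiUnique.
Variables (R : rcfType) (n : nat) (b V : nat -> R).
Hypotheses (b0 : b 0%N = 0) (bn : b n.+1 = 0).
Hypothesis b_gt0 : forall k, (0 < k <= n)%N -> 0 < b k.

Lemma jacobi_eigen_eq0 E x : jacobi_eigen n b V E x -> x 0%N = 0 ->
  forall k, (k <= n)%N -> x k = 0.
Proof.
move=> xP x0 k kn.
(* Two consecutive zeros propagate upwards because [b k.+1 > 0]; at index 0 the pair is [x 0]
   twice. *)
suff : (k <= n)%N -> x k.-1 = 0 /\ x k = 0 by case/(_ kn).
elim: k {kn} => [//|k IH kn] /=.
have [x1 x2] := IH (ltnW kn); split=> //.
have := xP k (ltnW kn); rewrite x1 x2 !mulr0 subr0 sub0r => /eqP.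
by rewrite oppr_eq0 mulf_eq0 gt_eqF ?b_gt0 // => /eqP.
Qed.

(** At a zero of a nonnegative eigenvector the weighted neighbours sum to 0, so the left neighbour
    vanishes too; descending to index 0 kills the whole vector. *)
Lemma jacobi_eigen_gt0 E x : jacobi_eigen n b V E x ->
  (forall k, 0 <= x k) -> (exists2 k, (k <= n)%N & x k != 0) ->
  forall k, (k <= n)%N -> 0 < x k.
Proof.
move=> xP x_ge0 [j jn /eqP xj] k kn; rewrite lt_neqAle x_ge0 andbT eq_sym.
apply/eqP => xk; apply: xj; apply: (jacobi_eigen_eq0 xP) => //.
elim: k kn xk => // k IH kn xk; apply: IH; first exact: ltnW.
have b1 : 0 < b k.+1 by rewrite b_gt0.
have b2 : 0 <= b k.+2 by apply: (edge_weight_ge0 b0 bn b_gt0).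
have := xP k.+1 kn; rewrite xk !mulr0 sub0r /=.
have := mulr_ge0 b2 (x_ge0 k.+2); have := mulr_ge0 (ltW b1) (x_ge0 k).
move=> h1 h2 h; have /eqP : b k.+1 * x k = 0 by lra.
by rewrite mulf_eq0 gt_eqF //= => /eqP.
Qed.
End JacobiUnique.

(** Convertible with the local [b] of [one_RM], so the inequalities of that condition apply as they
    stand. *)
Definition edge_weight (R : realType) (n : nat) (a : nat -> R) (k : nat) : R :=
  if (1 <= k <= n)%N then a k else 0.

Section Hamiltonian.
Variables (R : realType) (n : nat) (a : nat -> R) (V : 'I_n.+1 -> R).
Local Notation b := (edge_weight n a).
Local Notation H := (hamiltonian a V).

Lemma hamiltonianE (i j : 'I_n.+1) : H i j =
  V i *+ (i == j) - a j *+ (j == i.+1 :> nat) - a i *+ (i == j.+1 :> nat).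
Proof.
rewrite !mxE addrC -addrA -opprD; congr (_ - _).
have [ji|_] := eqVneq (j : nat) i.+1; last by case: eqP; rewrite add0r.
have -> : (i == j.+1 :> nat) = false by lia.
by rewrite addr0.
Qed.

Lemma hamiltonian_sym : H^T = H.
Proof.
apply/matrixP => i j; rewrite mxE !hamiltonianE eq_sym addrAC.
by congr (_ - _ - _); case: eqP => [->|].
Qed.

Lemma sum_pred1_ord (f : 'I_n.+1 -> R) (k : nat) :
  \sum_(i < n.+1) f i *+ (i == k :> nat) = if (k <= n)%N then f (inord k) else 0.
Proof.
case: leqP => kn.
  rewrite (bigD1 (inord k)) //= inordK // eqxx big1 ?addr0 // => i ik.
  by case: eqP => // ik'; case/eqP: ik; rewrite -ik' inord_val.
rewrite big1 // => i _; case: eqP => // ik.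
by have := ltn_ord i; rewrite ik ltnS leqNgt kn.
Qed.

Lemma jacobi_eigen_of_row (x : 'rV[R]_n.+1) E : x *m H = E *: x ->
  jacobi_eigen n b (fun k => V (inord k)) E (fun k => x 0 (inord k)).
Proof.
move=> /rowP xP k kn; have := xP (inord k); rewrite !mxE => <-.
have -> : \sum_i x 0 i * H i (inord k) =
    \sum_i (x 0 i * V i) *+ (i == k :> nat)
    - \sum_i (x 0 i * a k) *+ (i.+1 == k :> nat)
    - \sum_i (x 0 i * a i) *+ (i == k.+1 :> nat).
  rewrite -!sumrB; apply: eq_bigr => i _.
  by rewrite hamiltonianE -val_eqE /= inordK // [k == _]eq_sym !mulrBr !mulrnAr.
rewrite !sum_pred1_ord kn mulrC; congr (_ - _ - _).
  case: k kn => [|k] kn; first by rewrite big1 ?mul0r // => i _; rewrite mulr0n.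
  under eq_bigr => i _ do rewrite eqSS.
  by rewrite sum_pred1_ord ltnW // /b /= kn mulrC.
by rewrite /b /=; case: ifP => h; rewrite ?mul0r // inordK // mulrC.
Qed.

Hypothesis n_gt0 : (0 < n)%N.
Hypothesis a_gt0 : forall l : nat, (1 <= l <= n)%N -> 0 < a l.

Lemma edge_weight0 : b 0%N = 0. Proof. by []. Qed.

Lemma edge_weight_last : b n.+1 = 0.
Proof. by rewrite /edge_weight ltnn andbF. Qed.

Lemma edge_weight_gt0 k : (0 < k <= n)%N -> 0 < b k.
Proof. by move=> kn; rewrite /edge_weight kn a_gt0. Qed.

Lemma row_neq0_entry (x : 'rV[R]_n.+1) : x != 0 ->
  exists2 k, (k <= n)%N & x 0 (inord k) != 0.
Proof.
by case/rV0Pn=> i xi; exists i; rewrite ?inord_val // -ltnS.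
Qed.

Lemma row_eigen_eq0 (x : 'rV[R]_n.+1) E : x *m H = E *: x -> x 0 0 = 0 -> x = 0.
Proof.
move=> /jacobi_eigen_of_row xP x0; apply/rowP => i; rewrite mxE -(inord_val i).
apply: (jacobi_eigen_eq0 edge_weight_gt0 xP); last by rewrite -ltnS.
by rewrite -[RHS]x0; congr (x _ _); apply: val_inj; rewrite /= inordK.
Qed.

(** An eigenvector is determined by its entry 0, so any two are proportional. Hence [spectrum] has
    no repetitions. *)
Lemma rank_eigenspace_le1 E : (\rank (eigenspace H E) <= 1)%N.
Proof.
have [->|] := eqVneq (eigenspace H E) 0; first by rewrite mxrank0.
case/rowV0Pn => v /eigenspaceP vP v0.
have v00 : v 0 0 != 0 by apply: contra_neq v0 => h; apply: row_eigen_eq0 vP h.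
apply: leq_trans (rank_leq_row v); apply: mxrankS; apply/rV_subP => w /eigenspaceP wP.
suff -> : w = (w 0 0 / v 0 0) *: v by rewrite scalemx_sub.
apply/eqP; rewrite -subr_eq0; apply/eqP; apply: (@row_eigen_eq0 _ E).
  by rewrite mulmxBl wP -scalemxAl vP scalerBr !scalerA mulrC.
by rewrite !mxE divfK // subrr.
Qed.

Lemma hamiltonian_offdiag_le0 (i j : 'I_n.+1) : i != j -> H i j <= 0.
Proof.
move=> ij; rewrite hamiltonianE (negPf ij) mulr0n sub0r -opprD oppr_le0.
rewrite addr_ge0 //; case: eqP => [h|_]; rewrite // mulr1n ltW // a_gt0 // h /=.
  by rewrite -ltnS -h ltn_ord.
by rewrite -ltnS -h ltn_ord.
Qed.

(** The Perron-Frobenius argument: off-diagonal entries are nonpositive, so passing to absolute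
    values cannot raise the form. *)
Lemma hamiltonian_quad_abs (x y : 'rV[R]_n.+1) :
  (forall i, y 0 i = `|x 0 i|) -> dot (y *m H) y <= dot (x *m H) x.
Proof.
move=> yE; have quadE (z : 'rV[R]_n.+1) :
    dot (z *m H) z = \sum_j \sum_i (z 0 i * z 0 j) * H i j.
  rewrite dotE; apply: eq_bigr => j _; rewrite [(_ *m _) _ _]mxE mulr_suml.
  by apply: eq_bigr => i _; rewrite mulrAC.
rewrite !quadE; apply: ler_sum => j _; apply: ler_sum => i _.
rewrite !yE.
have [->|ij] := eqVneq i j; first by rewrite -!expr2 real_normK ?num_real.
by rewrite -normrM ler_wnM2r ?hamiltonian_offdiag_le0 // ler_norm.
Qed.

(** The absolute value of a minimizer is again a minimizer, an eigenvector by [psd_ker], and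
    strictly positive by [jacobi_eigen_gt0]. *)
Lemma ground_row_exists : exists mu : R, exists psi : 'rV[R]_n.+1,
  [/\ psi *m H = mu *: psi, forall i, 0 < psi 0 i
    & forall x : 'rV[R]_n.+1, mu * dot x x <= dot (x *m H) x].
Proof.
have [mu [muP [x x0 xP]]] := symmetric_min_eigen hamiltonian_sym.
pose y : 'rV[R]_n.+1 := \row_i `|x 0 i|.
have yx : dot y y = dot x x.
  by rewrite !dotE; apply: eq_bigr => i _; rewrite !mxE -!expr2 real_normK ?num_real.
pose B := H - mu%:M.
have sB : B^T = B by rewrite /B linearB /= hamiltonian_sym tr_scalar_mx.
have BE u : dot (u *m B) u = dot (u *m H) u - mu * dot u u.
  by rewrite mulmxBr mul_mx_scalar dotBl dotZl.
have pB : psd B by move=> u; rewrite BE subr_ge0; apply: muP.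
have yH : y *m H = mu *: y.
  apply/eqP; rewrite -subr_eq0 -mul_mx_scalar -mulmxBr; apply/eqP.
  apply: psd_ker => //; apply/eqP; rewrite eq_le pB andbT BE subr_le0.
  rewrite yx -dotZl -xP; apply: hamiltonian_quad_abs => i; exact: mxE.
exists mu, y; split=> // i; rewrite -(inord_val i).
apply: (jacobi_eigen_gt0 edge_weight0 edge_weight_last edge_weight_gt0
         (jacobi_eigen_of_row yH)); last by rewrite -ltnS.
  by move=> k; rewrite mxE.
by have [k kn xk] := row_neq0_entry x0; exists k; rewrite // mxE normr_eq0.
Qed.

(* The maximum of the form is an eigenvalue; it is not mu, for otherwise H
   would be scalar. *)
Lemma larger_eigenvalue_exists (mu : R) :
  (forall x : 'rV[R]_n.+1, mu * dot x x <= dot (x *m H) x) ->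
  exists2 nu, nu != mu & eigenvalue H nu.
Proof.
move=> muP.
have sN : (- H)^T = - H by rewrite linearN /= hamiltonian_sym.
have [nu [nuP [x x0 xP]]] := symmetric_min_eigen sN.
exists (- nu); last first.
  by apply/eigenvalueP; exists x => //; rewrite scaleNr -xP mulmxN opprK.
apply/eqP => nu_mu.
pose B := H - mu%:M.
have sB : B^T = B by rewrite /B linearB /= hamiltonian_sym tr_scalar_mx.
have BE u : dot (u *m B) u = dot (u *m H) u - mu * dot u u.
  by rewrite mulmxBr mul_mx_scalar dotBl dotZl.
have pB : psd B by move=> u; rewrite BE subr_ge0; apply: muP.
have B0 (u : 'rV[R]_n.+1) : u *m B = 0.
  apply: psd_ker => //; apply/eqP; rewrite eq_le pB andbT BE.
  have := nuP u; rewrite mulmxN -scaleN1r dotZl -nu_mu; lra.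
have j1 : (1 < n.+1)%N by [].
have : B 0 (Ordinal j1) = 0.
  by have /rowP/(_ (Ordinal j1)) := B0 (delta_mx 0 0); rewrite -rowE 2!mxE => ->; rewrite mxE.
rewrite /B mxE [X in _ + X]mxE [X in _ - X]mxE hamiltonianE /= !mulr0n !mulr1n.
have := a_gt0 (l := 1%N); rewrite n_gt0 => /(_ isT) a1.
by rewrite subr0 sub0r subr0 => /eqP; rewrite oppr_eq0 gt_eqF.
Qed.

Lemma spectrum_rootsR : spectrum H = rootsR (char_poly H).
Proof.
rewrite /spectrum.
have cp0 : char_poly H != 0 by rewrite monic_neq0 // char_poly_monic.
have : all (fun x => \rank (eigenspace H x) == 1%N) (rootsR (char_poly H)).
  apply/allP => x; rewrite -(roots_on_rootsR cp0) => /andP[_].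
  rewrite -eigenvalue_root_char => ex.
  by rewrite eqn_leq rank_eigenspace_le1 lt0n mxrank_eq0.
by elim: (rootsR _) => //= x s IH /andP[/eqP -> /IH ->].
Qed.

(** The spectrum is the strictly sorted list of eigenvalues. Minimality puts [E] at its head, and a
    second eigenvalue exists, so the default value of [nth] is never read. *)
Lemma spectral_gap_eigen (E : R) (x : 'rV[R]_n.+1) : x *m H = E *: x ->
  (forall i, 0 < x 0 i) ->
  (forall y : 'rV[R]_n.+1, E * dot y y <= dot (y *m H) y) ->
  lowest_eigenvalue H = E /\
  exists E' : R, [/\ E' != E, spectral_gap H = E' - E & eigenvalue H E'].
Proof.
move=> xP x_gt0 EP.
have x0 : x != 0.
  by apply/eqP => x0; have := x_gt0 0; rewrite x0 mxE ltxx.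
have cp0 : char_poly H != 0 by rewrite monic_neq0 // char_poly_monic.
have memE e : (e \in rootsR (char_poly H)) = eigenvalue H e.
  by rewrite -(roots_on_rootsR cp0) in_itv /= eigenvalue_root_char.
have EH : eigenvalue H E by apply/eigenvalueP; exists x.
have E_le e : eigenvalue H e -> E <= e.
  case/eigenvalueP => y yP /dot_gt0 y0.
  by have := EP y; rewrite yP dotZl ler_pM2r.
have [nu nuE nuH] := larger_eigenvalue_exists EP.
rewrite /lowest_eigenvalue /spectral_gap spectrum_rootsR.
have := sorted_roots (- cauchy_bound (char_poly H)) (cauchy_bound (char_poly H))
  (char_poly H).
rewrite -/(rootsR _); move: memE; case: (rootsR _) => [|e1 s] memE.
  by have := memE E; rewrite EH.
move=> s_sorted.
have e1E : e1 = E.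
  apply/le_anti; rewrite [E <= _]E_le -?memE ?mem_head // andbT.
  have := memE E; rewrite EH inE => /orP[/eqP -> //|Es].
  by apply/ltW; apply: (allP (order_path_min lt_trans s_sorted)).
subst e1; case: s memE s_sorted => [|e2 s] memE s_sorted.
  by have := memE nu; rewrite nuH inE (negPf nuE).
split=> //; exists e2; split=> //; last by rewrite -memE !inE eqxx orbT.
by case/andP: s_sorted => lt12 _; rewrite gt_eqF.
Qed.

End Hamiltonian.

(** * The uniform and the hypercube weights *)

Section Gap.
Variables (R : realType) (n : nat) (a : nat -> R) (V : 'I_n.+1 -> R).
Local Notation b := (edge_weight n a).
Local Notation H := (hamiltonian a V).
Local Notation W := (fun k => V (inord k)).
Local Notation E := (lowest_eigenvalue H).
Hypothesis n_gt0 : (0 < n)%N.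
Hypothesis a_gt0 : forall l : nat, (1 <= l <= n)%N -> 0 < a l.

Lemma second_eigenvector : exists E' : R, exists v : nat -> R,
  [/\ E' != E, spectral_gap H = E' - E, jacobi_eigen n b W E' v
    & exists2 k, (k <= n)%N & v k != 0].
Proof.
have [mu [x [xP x_gt0 muP]]] := ground_row_exists V a_gt0.
have [-> [E' [E'mu gapE /eigenvalueP[v vP v0]]]] :=
  spectral_gap_eigen n_gt0 a_gt0 xP x_gt0 muP.
exists E', (fun k => v 0 (inord k)); split=> //; first exact: jacobi_eigen_of_row.
exact: row_neq0_entry.
Qed.

(** Unnormalized, so that it covers both a given ground state and the one constructed when only a
    condition on [V] is assumed. *)
Definition ground_fun (psi : nat -> R) :=
  (forall k, (k <= n)%N -> 0 < psi k) /\ jacobi_eigen n b W E psi.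

Lemma ground_fun_exists : exists psi, ground_fun psi.
Proof.
have [mu [x [xP x_gt0 muP]]] := ground_row_exists V a_gt0.
have [lowE _] := spectral_gap_eigen n_gt0 a_gt0 xP x_gt0 muP.
exists (fun k => x 0 (inord k)); split=> //.
by rewrite lowE; apply: jacobi_eigen_of_row.
Qed.

Lemma ground_fun_of_state psi : ground_state H psi ->
  ground_fun (fun k => psi (inord k) 0).
Proof.
case=> psiP psi_gt0 _; split=> //.
have trP : psi^T *m H = E *: psi^T.
  by rewrite -{1}(hamiltonian_sym a V) -trmx_mul psiP linearZ.
by move=> k kn; have := jacobi_eigen_of_row trP kn; rewrite !mxE.
Qed.

Let b0 : b 0%N = 0 := edge_weight0 n a.
Let bn : b n.+1 = 0 := edge_weight_last n a.
Let b_gt0 := edge_weight_gt0 a_gt0.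

Lemma edge_weight_in k : (0 < k <= n)%N -> b k = a k.
Proof. by rewrite /edge_weight => ->. Qed.

Section GroundFunction.
Variable psi : nat -> R.
Hypothesis psiP : ground_fun psi.
Let psi_gt0 := psiP.1.

Definition nat_log_concave (f : nat -> R) :=
  forall k, (0 < k < n)%N -> f k.-1 * f k.+1 <= f k ^+ 2.

(** The second difference of [y k = k (n+1-k)] is -2, and [y k <= n^2] for [1 <= k <= n]. *)
Lemma gap_uniform : (forall l : nat, (1 <= l <= n)%N -> a l = 1) ->
  nat_log_concave psi -> 1 / n%:R ^+ 2 <= spectral_gap H.
Proof.
move=> a1 lc; have [E' [v [EE' -> vP v0]]] := second_eigenvector.
pose y k : R := k%:R * (n.+1%:R - k%:R).
apply: (gap_ge_log_concave n_gt0 b0 bn b_gt0 psi_gt0 psiP.2 vP (y := y)) => //.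
- by move=> k kn; rewrite /y mulr_gt0 ?subr_gt0 ?ltr0n ?ltr_nat //; lia.
- by rewrite /y mul0r.
- by rewrite /y subrr mulr0.
case=> // k /= kn; rewrite edge_weight_in // a1 // mul1r /y /=.
have n0 : 0 < n%:R :> R by rewrite ltr0n.
have k1 : k.+1%:R <= n%:R :> R by rewrite ler_nat.
have k0 : 0 <= k%:R :> R by rewrite ler0n.
rewrite ler_pdivrMl ?exprn_gt0 // !mul1r.
move: k1; rewrite -(natr1 k.+1) -(natr1 k) -(natr1 n); nra.
Qed.

(** With unit weights the left-hand sides of [rel_mono] are increments of [V] towards the well,
    hence nonpositive, while the right-hand sides are nonnegative. *)
Lemma single_well_log_concave : (forall l : nat, (1 <= l <= n)%N -> a l = 1) ->
  single_well V -> nat_log_concave psi.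
Proof.
move=> a1 [k0 [Vl Vr]].
have b1 k : (0 < k <= n)%N -> b k = 1.
  by move=> kn; rewrite edge_weight_in ?a1.
have b01 k : 0 <= b k <= 1.
  by rewrite /edge_weight; case: ifP => [kn|]; rewrite ?a1 ?lexx ?ler01.
have F_ge0 k : (k <= n)%N -> 0 <= (W k - E)^-1.
  move=> kn; rewrite invr_ge0 (ground_potentialE psi_gt0 psiP.2 kn).
  (* The value [psi n.+1] has no known sign; at [k = n] its term disappears with [b n.+1 = 0]. *)
  have [->|kn1] := eqVneq k n; last first.
    have kn2 : (k.+1 <= n)%N by rewrite ltn_neqAle kn1.
    have [/andP[h1 _] /andP[h2 _]] := (b01 k, b01 k.+1).
    rewrite addr_ge0 // mulr_ge0 // divr_ge0 // ltW ?psi_gt0 //.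
    exact: leq_trans (leq_pred k) kn.
  have bn1 : b n = 1 by rewrite b1 // n_gt0 leqnn.
  rewrite bn mul0r add0r bn1 mul1r divr_ge0 // ltW ?psi_gt0 //.
  exact: leq_pred.
apply: (ground_log_concave_of_rel_mono n_gt0 b0 bn b_gt0 psi_gt0 psiP.2).
  move=> k kn; rewrite (b1 k kn) expr1n.
  have /andP[h1 h2] := b01 k.-1; have /andP[h3 h4] := b01 k.+1.
  by rewrite mulr_ile1.
exists k0; split=> k.
  move=> kk kn; have kn2 : (0 < k <= n)%N by lia.
  have k1n : (0 < k.+1 <= n)%N by lia.
  rewrite (b1 k kn2) (b1 k.+1 k1n) (b1 1%N n_gt0) expr1n !mul1r.
  have /andP[_ h] := b01 k.-1.
  have := mulr_ge0 (F_ge0 0%N isT) (_ : 0 <= 1 - b k.-1); rewrite subr_ge0 => /(_ h).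
  have : V (inord k) <= V (inord k.-1) by apply: Vl; rewrite !inordK; lia.
  by move: (_ * _) => z; lra.
move=> kk; have kn2 : (0 < k <= n)%N by lia.
have k1n : (0 < k.+1 <= n)%N by lia.
have bn1 : b n = 1 by rewrite b1 // n_gt0 leqnn.
rewrite (b1 k kn2) (b1 k.+1 k1n) bn1 expr1n mulr1 !mul1r.
have /andP[_ h] := b01 k.+2.
have := mulr_ge0 (F_ge0 n (leqnn n)) (_ : 0 <= 1 - b k.+2).
rewrite subr_ge0 => /(_ h).
have : V (inord k) <= V (inord k.+1) by apply: Vr; rewrite !inordK; lia.
by move: (_ * _) => z; lra.
Qed.

Hypothesis aE :
  forall l : nat, (1 <= l <= n)%N -> a l = Num.sqrt (l * (n.+1 - l))%:R.

Lemma edge_weight_sqr k : (k <= n.+1)%N -> b k ^+ 2 = k%:R * (n.+1%:R - k%:R).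
Proof.
move=> kn; rewrite -natrB // -natrM /edge_weight; case: ifP => h.
  by rewrite aE // sqr_sqrtr ?ler0n.
have /orP[/eqP -> |/eqP ->] : (k == 0%N) || (k == n.+1) by lia.
  by rewrite expr0n.
by rewrite subnn muln0 expr0n.
Qed.

Let b_ge0 := edge_weight_ge0 b0 bn b_gt0.

Lemma edge_weight_log_concave k : (0 < k <= n)%N -> b k.-1 * b k.+1 <= b k ^+ 2.
Proof.
case: k => // k /= kn.
have h1 : 0 <= b k by rewrite b_ge0 // ltnW // ltnW.
have h2 : 0 <= b k.+2 by rewrite b_ge0.
suff : (b k * b k.+2) ^+ 2 <= (b k.+1 ^+ 2) ^+ 2.
  by rewrite ler_sqr // nnegrE; [apply: mulr_ge0|apply: sqr_ge0].
rewrite exprMn !edge_weight_sqr //; try lia.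
have k0 : 0 <= k%:R :> R by rewrite ler0n.
have : k.+1%:R <= n%:R :> R by rewrite ler_nat.
rewrite -(natr1 k.+1) -(natr1 k) -(natr1 n).
set x := k%:R; set z := n%:R => xz.
(* With [u = x + 1] and [w = z - x], both at least 1, the claim becomes
   [(u^2 - 1) (w^2 - 1) <= u^2 w^2]. *)
have -> : x * (z + 1 - x) * ((x + 1 + 1) * (z + 1 - (x + 1 + 1))) =
  ((x + 1) ^+ 2 - 1) * ((z - x) ^+ 2 - 1) by ring.
have -> : ((x + 1) * (z + 1 - (x + 1))) ^+ 2 = (x + 1) ^+ 2 * (z - x) ^+ 2 by ring.
have : 1 <= (x + 1) ^+ 2 by rewrite expr_ge1 //; lra.
have : 1 <= (z - x) ^+ 2 by rewrite expr_ge1 //; lra.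
by nra.
Qed.

(** For [y = b] it suffices that the second difference of [b] is at most [- 1 / n]. *)
Lemma gap_hypercube_log_concave :
  nat_log_concave psi -> 1 / n%:R <= spectral_gap H.
Proof.
move=> lc; have [E' [v [EE' -> vP v0]]] := second_eigenvector.
apply: (gap_ge_log_concave n_gt0 b0 bn b_gt0 psi_gt0 psiP.2 vP (y := b)) => //.
  by rewrite bn.
case=> // k /= kn; rewrite mulrC ler_pM2l ?b_gt0 //.
have n0 : 0 < n%:R :> R by rewrite ltr0n.
have k1 : k.+1%:R <= n%:R :> R by rewrite ler_nat.
have k0 : 0 <= k%:R :> R by rewrite ler0n.
have x_ge0 : 0 <= b k by rewrite b_ge0 // ltnW // ltnW.
have z_ge0 : 0 <= b k.+2 by rewrite b_ge0.
have y_gt0 : 0 < b k.+1 by rewrite b_gt0.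
have x2 := edge_weight_sqr (leqW (ltnW kn)).
have y2 := edge_weight_sqr (leqW kn).
have z2 := edge_weight_sqr (kn : (k.+2 <= n.+1)%N).
move: x2 y2 z2 k1; rewrite -(natr1 k.+1) -(natr1 k) -(natr1 n).
move: (b k) (b k.+1) (b k.+2) x_ge0 y_gt0 z_ge0 => x y z x_ge0 y_gt0 z_ge0.
move: n%:R k%:R n0 k0 => N K N0 K0 x2 y2 z2 KN.
have yN : y <= N by rewrite -ler_sqr ?nnegrE; [nra|lra|lra].
have y1 : 1 <= y by rewrite -ler_sqr ?nnegrE; [nra|lra|lra].
have N1 : 0 < N^-1 by rewrite invr_gt0.
have yN1 : y * N^-1 <= 1 by rewrite ler_pdivrMr // mul1r.
have Ny : N^-1 <= 1 by rewrite invf_le1 //; lra.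
rewrite div1r leNgt; apply/negP.
move: N^-1 N1 yN1 Ny => p p0 yp p1 lt.
have xz : (x + z) ^+ 2 <= 4 * y ^+ 2 - 4.
  have := sqr_ge0 (x - z); have : x ^+ 2 + z ^+ 2 = 2 * y ^+ 2 - 2.
    by rewrite x2 y2 z2; ring.
  by nra.
(* Write [p = 1 / n]. Since [b^2] has second difference -2, [(x + z)^2 <= 4 y^2 - 4]; were
   [x + z > 2 y - p], squaring would give [4 y p - p^2 > 4], contradicting [y p <= 1]. *)
have lt2 : 2 * y - p < x + z by lra.
have : (2 * y - p) ^+ 2 < (x + z) ^+ 2 by rewrite ltr_sqr // nnegrE; lra.
by nra.
Qed.

(* The square root of the ratio of consecutive p_k / C(n, k). *)
Definition hypercube_ratio k := k%:R * (psi k / psi k.-1) / b k.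
Local Notation t := hypercube_ratio.

Lemma hypercube_ratio_gt0 k : (0 < k <= n)%N -> 0 < t k.
Proof.
case: k => // k /= kn.
by rewrite divr_gt0 ?b_gt0 // mulr_gt0 ?ltr0n // divr_gt0 ?psi_gt0 // ltnW.
Qed.

Lemma hypercube_ratio_right k : (0 < k <= n)%N ->
  b k * (psi k / psi k.-1) = (n.+1 - k)%:R * t k.
Proof.
case: k => // k /= kn; have bk : 0 < b k.+1 by rewrite b_gt0.
rewrite natrB ?leqW // /t; apply: (@mulIf _ (b k.+1)); first by rewrite gt_eqF.
have h := edge_weight_sqr (leqW kn).
rewrite mulrAC -expr2 h /=; field.
by rewrite !gt_eqF // psi_gt0 // ltnW.
Qed.

Lemma hypercube_ratio_left k : (0 < k <= n)%N ->
  b k * (psi k.-1 / psi k) = k%:R / t k.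
Proof.
case: k => // k /= kn; have bk : 0 < b k.+1 by rewrite b_gt0.
rewrite /t /=; have : 0 < k.+1%:R :> R by rewrite ltr0n.
move: k.+1%:R => z z0; field.
by rewrite !gt_eqF // psi_gt0 // ltnW.
Qed.

Lemma gap_hypercube_ratio : (forall k, (0 < k < n)%N -> t k.+1 <= t k) ->
  1 <= spectral_gap H.
Proof.
move=> tmono; have [E' [v [EE' -> vP v0]]] := second_eigenvector.
exact: (gap_ge_ultra_log_concave n_gt0 b0 bn b_gt0 psi_gt0 psiP.2 vP EE' v0
  hypercube_ratio_gt0 hypercube_ratio_right hypercube_ratio_left).
Qed.

Lemma hypercube_ratio_sqr k : (0 < k <= n)%N ->
  t k ^+ 2 = (psi k ^+ 2 / 'C(n, k)%:R) / (psi k.-1 ^+ 2 / 'C(n, k.-1)%:R).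
Proof.
case: k => // k /= kn.
have p0 : 0 < psi k by rewrite psi_gt0 // ltnW.
have c1 : 0 < 'C(n, k.+1)%:R :> R by rewrite ltr0n bin_gt0.
have nk : 0 < (n - k)%:R :> R by rewrite ltr0n subn_gt0.
have k0 : 0 < k.+1%:R :> R by rewrite ltr0n.
have cE : 'C(n, k)%:R = k.+1%:R * 'C(n, k.+1)%:R / (n - k)%:R :> R.
  by rewrite -natrM mul_bin_left natrM mulrAC divff ?mul1r // gt_eqF.
rewrite cE /t /= !expr_div_n exprMn edge_weight_sqr ?leqW // -natrB ?leqW // subSS.
have p1 : 0 < psi k.+1 by rewrite psi_gt0.
move: (psi k) (psi k.+1) p0 p1 k.+1%:R (n - k)%:R 'C(n, k.+1)%:R k0 nk c1.
by move=> x y x0 y0 z w c z0 w0 c0 {cE}; field; rewrite !gt_eqF.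
Qed.

End GroundFunction.
End Gap.

Theorem theorem5 (R : realType) :
  exists2 c : R, 0 < c &
  forall (n : nat) (a : nat -> R) (V : 'I_n.+1 -> R),
  (1 <= n)%N ->
  (forall l : nat, (1 <= l <= n)%N -> 0 < a l) ->
  let H := hamiltonian a V in
  [/\ (forall l : nat, (1 <= l <= n)%N -> a l = 1) ->
      (forall psi, ground_state H psi -> log_concave (ground_dist psi) ->
         c / n%:R ^+ 2 <= spectral_gap H) /\
      (single_well V -> c / n%:R ^+ 2 <= spectral_gap H),
      (forall l : nat, (1 <= l <= n)%N -> a l = Num.sqrt (l * (n.+1 - l))%:R) ->
      (forall psi, ground_state H psi -> log_concave (ground_dist psi) ->
         c / n%:R <= spectral_gap H) /\
      (one_RM a V -> c / n%:R <= spectral_gap H)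
    & (forall l : nat, (1 <= l <= n)%N -> a l = Num.sqrt (l * (n.+1 - l))%:R) ->
      (forall psi, ground_state H psi -> ultra_log_concave (ground_dist psi) ->
         c <= spectral_gap H) /\
      (convex_potential V -> c <= spectral_gap H)].
Proof.
exists 1; first exact: ltr01.
move=> n a V n_gt0 a_gt0 H.
have [phi phiP] := ground_fun_exists V n_gt0 a_gt0.
(* As [psi] is positive, log-concavity of its square is log-concavity of [psi]. *)
have lcP psi : ground_state H psi -> log_concave (ground_dist psi) ->
    nat_log_concave n (fun k => psi (inord k) 0).
  move=> [_ psi_gt0 _] lc k kn; have := lc k kn; rewrite /ground_dist -exprMn.
  by rewrite ler_sqr // nnegrE ?mulr_ge0 ?sqr_ge0 // ltW.
split=> aE; split.
- by move=> psi gs lc; apply: (gap_uniform n_gt0 a_gt0 (ground_fun_of_state gs)) => //;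
    apply: lcP.
- move=> sw; apply: (gap_uniform n_gt0 a_gt0 phiP) => //.
  exact: (single_well_log_concave n_gt0 a_gt0 phiP).
- move=> psi gs lc.
  apply: (gap_hypercube_log_concave n_gt0 a_gt0 (ground_fun_of_state gs)) => //.
  exact: lcP.
- move=> [k0 _ [h1 h2]]; apply: (gap_hypercube_log_concave n_gt0 a_gt0 phiP) => //.
  apply: (ground_log_concave_of_rel_mono n_gt0 (edge_weight0 n a)
    (edge_weight_last n a) (edge_weight_gt0 a_gt0) phiP.1 phiP.2).
    exact: edge_weight_log_concave.
  exists k0; split=> k; first by move=> kk _; apply: h1.
  by move=> kk; apply: h2; lia.
- move=> psi gs ulc; have psiP := ground_fun_of_state gs.
  apply: (gap_hypercube_ratio n_gt0 a_gt0 psiP aE) => k kn.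
  have k1 : (0 < k <= n)%N by lia.
  have k2 : (0 < k.+1 <= n)%N by lia.
  have t1 := hypercube_ratio_gt0 a_gt0 psiP k1.
  have t2 := hypercube_ratio_gt0 a_gt0 psiP k2.
  (* The squares of the ratios are quotients of consecutive [p_k / C(n, k)], whose monotonicity is
     ultra-log-concavity. *)
  rewrite -ler_sqr ?nnegrE; [|exact: ltW|exact: ltW].
  rewrite !(hypercube_ratio_sqr n_gt0 psiP aE) //=.
  have := ulc k kn; rewrite /= /ground_dist !inordK; try lia.
  move=> kulc.
  have P_gt0 j : (j <= n)%N -> 0 < psi (inord j) 0 ^+ 2 / 'C(n, j)%:R.
    by move=> jn; rewrite divr_gt0 ?ltr0n ?bin_gt0 // exprn_gt0 // psiP.1.
  have ratio (x y z : R) : 0 < x -> 0 < y -> x * z <= y ^+ 2 -> z / y <= y / x.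
    move=> x_gt0 y_gt0 h.
    by rewrite ler_pdivrMr // mulrAC ler_pdivlMr // mulrC -expr2.
  by apply: ratio kulc; apply: P_gt0; lia.
- move=> cV; apply: (gap_hypercube_ratio n_gt0 a_gt0 phiP aE).
  apply: (ground_ratio_nonincreasing_of_convex n_gt0 (edge_weight0 n a)
    (edge_weight_last n a) phiP.1 phiP.2
    (hypercube_ratio_gt0 a_gt0 phiP) (hypercube_ratio_right n_gt0 a_gt0 phiP aE)
    (hypercube_ratio_left a_gt0 phiP)).
  exact: cV.
Qed.
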